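(* Let $V$ be a finite set, let $R \subseteq A \subseteq V$ be non-empty subsets of $V$, and let $B := V\setminus A$. Let $M>0$ and let $g: 2^B \to \mathbb{R}$ be a submodular function taking values in $[0,M]$ that has a unique minimizer $S_g^* \subseteq B$. Let $F := F^{M,g}_{V,A,R} : 2^V \to \mathbb{R}$ be given by $$F^{M,g}_{V,A,R}(S) := f_{A,R}(S \cap A) + \frac{1}{2|V|}\,\phi_{V,A,R}(S) + \frac{1}{4M|V|}\,\mathbf{1}(S\cap A = R)\, g(S\cap B).$$ Then: 1. (Non-negativity and boundedness) for every $S \subseteq V$, $F(S) \in [0,2]$; 2. (Unique minimizer) $F$ has a unique minimizer, namely $R \cup S_g^*$; 3. (Submodularity) $F$ is submodular.
   Context: A function $f: 2^V \to \mathbb{R}$ on subsets of a finite set $V$ is submodular if $f(X)+f(Y) \ge f(X\cup Y) + f(X \cap Y)$ for all $X, Y \subseteq V$. $\subsetneq$ and $\supsetneq$ denote strict inclusion; $\mathbf{1}(\cdot)$ is the indicator ($1$ if the condition holds, $0$ otherwise). For $R\subseteq A$, the function $f_{A,R}: 2^A \to \mathbb{R}$ is $$f_{A,R}(S) := \begin{cases} 0 & \text{if } S = R,\\ 1 & \text{if } S \subsetneq R \text{ or } S \supsetneq R,\\ 2 & \text{otherwise.}\end{cases}$$ For $R \subseteq A\subseteq V$ and $B := V\setminus A$, writing $S_A := S\cap A$ and $S_B := S\cap B$, the function $\phi_{V,A,R}: 2^V\to\mathbb{R}$ is $$\phi_{V,A,R}(S) := \begin{cases} |S_B| & \text{if }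 S_A \subsetneq R,\\ -|S_B| & \text{if } S_A \supsetneq R,\\ 0 & \text{otherwise (in particular if } S_A = R).\end{cases}$$ *)

(* Defs.v *)
From HB Require Import structures.
From mathcomp Require Import all_boot all_order all_algebra.
From mathcomp Require Import reals.

Set Implicit Arguments.
Unset Strict Implicit.
Unset Printing Implicit Defensive.

Import Order.TTheory GRing.Theory Num.Theory.

Local Open Scope ring_scope.

(* A function 2^U -> K, for a subset U of the finite ground set T, is encoded
   as a total function {set T} -> K of which only the values at subsets of U
   are ever constrained or used. *)

Definition submodular_on (T : finType) (K : realType) (U : {set T})
    (h : {set T} -> K) : Prop :=
  forall X Y : {set T}, X \subset U -> Y \subset U ->
    h (X :|: Y) + h (X :&: Y) <= h X + h Y.

Definition minimizer_on (T : finType) (K : realType) (U : {set T})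
    (h : {set T} -> K) (S : {set T}) : Prop :=
  S \subset U /\ forall X : {set T}, X \subset U -> h S <= h X.

Definition unique_minimizer_on (T : finType) (K : realType) (U : {set T})
    (h : {set T} -> K) (S : {set T}) : Prop :=
  unique (minimizer_on U h) S.

(* f_{A,R}; the set A only determines the domain 2^A, so it is not an
   argument. *)
Definition fR (K : realType) (V : finType) (R : {set V}) (S : {set V}) : K :=
  if S == R then 0
  else if (S \proper R) || (R \proper S) then 1
  else 2.

Definition phi (K : realType) (V : finType) (A R : {set V}) (S : {set V}) : K :=
  if S :&: A \proper R then #|S :&: ~: A|%:R
  else if R \proper S :&: A then - #|S :&: ~: A|%:R
  else 0.

Definition F (K : realType) (V : finType) (A R : {set V}) (M : K)
    (g : {set V} -> K) (S : {set V}) : K :=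
  fR K R (S :&: A)
  + 1 / (2 * #|V|%:R) * phi K A R S
  + 1 / (4 * M * #|V|%:R) * (S :&: A == R)%:R * g (S :&: ~: A).

(* Main.v *)
(** Write [c = 1/(2|V|)] and let [h] be the rescaled [g], so that [0 <= h <= c/2].
    The value [F S] depends only on how [S :&: A] compares with [R], on
    [#|S :\: A|] and on [h (S :\: A)].  Submodularity is a case analysis on
    the position of [X :&: A] and [Y :&: A] relative to [R].  If both equal [R]
    it is the submodularity of [h].  The only other delicate case is
    [X :&: A = R] with [Y :&: A] strictly comparable to [R]: either the parts
    outside [A] are nested and equality holds, or the term [phi] gains at least
    [c], which exceeds the oscillation of [h]. *)
Require Import Defs.
From mathcomp Require Import all_boot all_order all_algebra.
From mathcomp Require Import reals.
From mathcomp Require Import ring lra.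

Import Order.TTheory GRing.Theory Num.Theory.

Local Open Scope ring_scope.

(** Equality, strict inclusion both ways and incomparability with [R] are the four outcomes of two
    Boolean tests, so later case analyses split on inclusions only. *)
Lemma F_cases (K : realType) (V : finType) (A R : {set V}) (M : K)
    (g : {set V} -> K) (S : {set V}) :
  F A R M g S =
    if S :&: A \subset R then
      if R \subset S :&: A then 1 / (4 * M * #|V|%:R) * g (S :&: ~: A)
      else 1 + 1 / (2 * #|V|%:R) * #|S :&: ~: A|%:R
    else if R \subset S :&: A then 1 - 1 / (2 * #|V|%:R) * #|S :&: ~: A|%:R
    else 2.
Proof.
rewrite /F /fR /phi !properE eqEsubset.
by case: (S :&: A \subset R); case: (R \subset S :&: A) => /=; lra.
Qed.

(** Serves the pair where one trace on [A] is [R] and the other is strictly inside it. If [Y] is not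
    inside [X], the intersection loses a point of [Y], and the resulting [c] pays for
    [h (X :|: Y)]. *)
Lemma perturbation_setU (K : realDomainType) (V : finType) (c : K)
    (h : {set V} -> K) (X Y : {set V}) :
  0 <= c -> 0 <= h X -> h (X :|: Y) <= c ->
  h (X :|: Y) + c * #|X :&: Y|%:R <= h X + c * #|Y|%:R.
Proof.
move=> c0 hX hU; have [sYX|nsYX] := boolP (Y \subset X).
  by rewrite (setUidPl sYX) (setIidPr sYX).
have : (#|X :&: Y| < #|Y|)%N.
  by rewrite proper_card // properE subsetIr subsetI subxx andbT.
rewrite -(ler_nat K) -natr1 => /(ler_wpM2l c0); lra.
Qed.

(** Counterpart for a trace strictly containing [R], where [phi] is negative: a point of [X] outside
    [Y] enlarges the union and pays for [h (X :&: Y)]. *)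
Lemma perturbation_setI (K : realDomainType) (V : finType) (c : K)
    (h : {set V} -> K) (X Y : {set V}) :
  0 <= c -> 0 <= h X -> h (X :&: Y) <= c ->
  h (X :&: Y) + c * #|Y|%:R <= h X + c * #|X :|: Y|%:R.
Proof.
move=> c0 hX hI; have [sXY|nsXY] := boolP (X \subset Y).
  by rewrite (setUidPr sXY) (setIidPl sXY).
have : (#|Y| < #|X :|: Y|)%N.
  by rewrite proper_card // properE subsetUr subUset subxx andbT.
rewrite -(ler_nat K) -natr1 => /(ler_wpM2l c0); lra.
Qed.

Theorem lemma3p2 (K : realType) (V : finType) (A R : {set V})
    (A_neq0 : A != set0) (R_neq0 : R != set0) (sRA : R \subset A)
    (M : K) (M_gt0 : 0 < M)
    (g : {set V} -> K)
    (g_submod : submodular_on (~: A) g)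
    (g_bound : forall X : {set V}, X \subset ~: A -> 0 <= g X <= M)
    (Sg : {set V}) (Sg_min : unique_minimizer_on (~: A) g Sg) :
  [/\ forall S : {set V}, 0 <= F A R M g S <= 2,
      unique_minimizer_on [set: V] (F A R M g) (R :|: Sg)
    & submodular_on [set: V] (F A R M g)].
Proof.
(* A point of [R] makes [V] nonempty: the denominators are nonzero and [c] is at most 1/2. *)
have V1 : 1 <= #|V|%:R :> K.
  by rewrite ler1n; have /set0Pn[x _] := R_neq0; apply/card_gt0P; exists x.
set c : K := 1 / (2 * #|V|%:R).
set k : K := 1 / (4 * M * #|V|%:R).
have c_gt0 : 0 < c by rewrite divr_gt0 //; lra.
have cV : c * #|V|%:R = 1 / 2 by rewrite /c; field; lra.
have c_le : c <= 1 / 2 by rewrite -cV ler_peMr // ltW.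
have k_gt0 : 0 < k by rewrite divr_gt0 // !mulr_gt0 //; lra.
have kM : k * M = c / 2 by rewrite /k /c; field; apply/andP; split; lra.
pose h X := k * g X.
have h_bound (X : {set V}) : X \subset ~: A -> 0 <= h X <= c / 2.
  move=> /g_bound/andP[g0 gM].
  by rewrite -kM mulr_ge0 ?(ltW k_gt0) //= ler_wpM2l // ltW.
have h_ge0 (X : {set V}) : X \subset ~: A -> 0 <= h X by case/h_bound/andP.
have h_lec (X : {set V}) : X \subset ~: A -> h X <= c.
  by case/h_bound/andP; lra.
have w_bound (X : {set V}) : 0 <= c * #|X|%:R <= 1 / 2.
  by rewrite -cV mulr_ge0 ?(ltW c_gt0) //= ler_wpM2l ?(ltW c_gt0) // ler_nat max_card.
have sB (S : {set V}) : S :&: ~: A \subset ~: A by apply: subsetIr.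
have FE S : F A R M g S =
    if S :&: A \subset R then
      if R \subset S :&: A then h (S :&: ~: A) else 1 + c * #|S :&: ~: A|%:R
    else if R \subset S :&: A then 1 - c * #|S :&: ~: A|%:R else 2.
  exact: F_cases.
have F_bound S : 0 <= F A R M g S <= 2.
  have /andP[] := h_bound _ (sB S); have /andP[] := w_bound (S :&: ~: A).
  by rewrite FE; case: ifP => _; case: ifP => _; lra.
split=> //.
- have [[sSg minSg] uniqSg] := Sg_min.
  have RSA : (R :|: Sg) :&: A = R.
    by rewrite setIUl (setIidPl sRA) [Sg :&: A]disjoint_setI0 ?setU0 // disjoints_subset.
  have RSB : (R :|: Sg) :&: ~: A = Sg.
    rewrite setIUl (setIidPl sSg) [R :&: _]disjoint_setI0 ?set0U //.
    by rewrite disjoints_subset setCK.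
  have FRS : F A R M g (R :|: Sg) = h Sg by rewrite FE RSA RSB subxx.
  have hSg := h_bound _ sSg.
  (* Away from trace [R], [F] is at least 1 - 1/2, whereas [h Sg <= c / 2 <= 1/4]. *)
  have F_gt (S : {set V}) : S :&: A != R -> h Sg < F A R M g S.
    rewrite FE eqEsubset; have := w_bound (S :&: ~: A).
    by case: (S :&: A \subset R); case: (R \subset S :&: A) => //=; lra.
  have F_eq (S : {set V}) : S :&: A = R -> F A R M g S = h (S :&: ~: A).
    by rewrite FE => ->; rewrite subxx.
  split; first split=> [|S _]; first exact: subsetT.
    rewrite FRS; have [/F_eq ->|/F_gt/ltW //] := eqVneq (S :&: A) R.
    by rewrite ler_pM2l // minSg.
  move=> S [_ /(_ (R :|: Sg) (subsetT _))]; rewrite FRS => FS_le.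
  have [SA|/F_gt] := eqVneq (S :&: A) R; last by rewrite ltNge FS_le.
  rewrite (F_eq _ SA) ler_pM2l // in FS_le.
  (* The part of [S] outside [A] does at least as well as [Sg] for [g], so it is a minimizer of [g]
     too. *)
  have -> : Sg = S :&: ~: A.
    by apply: uniqSg; split=> // X sX; apply: le_trans FS_le (minSg _ sX).
  by rewrite -SA -setIUr setUCr setIT.
- move=> X Y _ _; rewrite !FE !setIUl ![X :&: Y :&: _]setIIl.
  rewrite subUset subsetI.
  (* Of the four tests on the union and intersection, two have just become conjunctions of tests on
     [X] and [Y]; the other two are only implied in one direction. *)
  have bU : (R \subset X :&: A) || (R \subset Y :&: A) ->
      R \subset X :&: A :|: Y :&: A.
    by case/orP => /subset_trans; apply; rewrite ?subsetUl ?subsetUr.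
  have aI : (X :&: A \subset R) || (Y :&: A \subset R) ->
      X :&: A :&: (Y :&: A) \subset R.
    by case/orP; apply: subset_trans; rewrite ?subsetIl ?subsetIr.
  move: (sB X) (sB Y).
  move: (X :&: ~: A) (Y :&: ~: A) => X' Y' sX sY.
  have sU : X' :|: Y' \subset ~: A by rewrite subUset sX.
  have sI : X' :&: Y' \subset ~: A by rewrite (subset_trans (subsetIl _ _)).
  have h_sub : h (X' :|: Y') + h (X' :&: Y') <= h X' + h Y'.
    by rewrite -!mulrDr ler_pM2l // g_submod.
  have hX := h_bound _ sX; have hY := h_bound _ sY.
  have hU := h_bound _ sU; have hI := h_bound _ sI.
  have wX := w_bound X'; have wY := w_bound Y'.
  have wU := w_bound (X' :|: Y'); have wI := w_bound (X' :&: Y').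
  have w_mod : c * #|X' :|: Y'|%:R + c * #|X' :&: Y'|%:R
      = c * #|X'|%:R + c * #|Y'|%:R.
    by rewrite -!mulrDr -!natrD cardsUI.
  have wIX : c * #|X' :&: Y'|%:R <= c * #|X'|%:R.
    by rewrite ler_pM2l // ler_nat subset_leq_card // subsetIl.
  have wIY : c * #|X' :&: Y'|%:R <= c * #|Y'|%:R.
    by rewrite ler_pM2l // ler_nat subset_leq_card // subsetIr.
  have pUX : h (X' :|: Y') + c * #|X' :&: Y'|%:R <= h X' + c * #|Y'|%:R.
    exact: perturbation_setU (ltW c_gt0) (h_ge0 _ sX) (h_lec _ sU).
  have pUY : h (X' :|: Y') + c * #|X' :&: Y'|%:R <= h Y' + c * #|X'|%:R.
    rewrite setUC setIC; apply: perturbation_setU (ltW c_gt0) (h_ge0 _ sY) _.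
    by rewrite setUC h_lec.
  have pIX : h (X' :&: Y') + c * #|Y'|%:R <= h X' + c * #|X' :|: Y'|%:R.
    exact: perturbation_setI (ltW c_gt0) (h_ge0 _ sX) (h_lec _ sI).
  have pIY : h (X' :&: Y') + c * #|X'|%:R <= h Y' + c * #|X' :|: Y'|%:R.
    rewrite setUC setIC; apply: perturbation_setI (ltW c_gt0) (h_ge0 _ sY) _.
    by rewrite setIC h_lec.
  (* With the values of [h] and the weighted cardinalities as eight real unknowns, each remaining
     case is linear. *)
  move: (h X') (h Y') (h (X' :|: Y')) (h (X' :&: Y')) (c * #|X'|%:R)
    (c * #|Y'|%:R) (c * #|X' :|: Y'|%:R) (c * #|X' :&: Y'|%:R)
    h_sub hX hY hU hI wX wY wU wI w_mod wIX wIY pUX pUY pIX pIY.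
  move=> hX hY hU hI wX wY wU wI h_sub hX_bound hY_bound hU_bound hI_bound wX_bound wY_bound
    wU_bound wI_bound w_mod wIX wIY pUX pUY pIX pIY.
  clear V1 cV k_gt0 kM; clearbody c.
  (* The six tests are now free Booleans; [aI] and [bU] refute impossible combinations. *)
  case: (R \subset X :&: A :|: Y :&: A) bU;
    case: (X :&: A :&: (Y :&: A) \subset R) aI;
    case: (X :&: A \subset R); case: (R \subset X :&: A);
    case: (Y :&: A \subset R); case: (R \subset Y :&: A) => /= aI bU.
  all: by [have := aI isT | have := bU isT | lra].
Qed.
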